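(* Let $\mathcal{C}$ be a class of finite cographs. The following are equivalent: (1) $\mathcal{C}$ is $\mathrm{MSO}_1$-orderable; (2) $\mathcal{C}$ has property $\mathsf{CUT}$; (3) there is $d\in\mathbb{N}$ such that the cotree of every graph in $\mathcal{C}$ has outdegree at most $d$.
   Context: A cograph is a graph built from single vertices (constant $1$) using disjoint union $\oplus$ and complete join $\otimes$ (disjoint union plus all edges between the two parts). Regarding $\oplus,\otimes$ as operations of variable arity with unordered arguments, a cotree is a term over $\oplus,\otimes,1$ in which no node is labelled by the same operation as one of its immediate successors; every cograph is denoted by a unique cotree. $\lfloor G\rfloor$ is the structure with universe the vertex set and the edge relation. A graph class is $\mathrm{MSO}_1$-orderable if there is an MSO-formula $\varphi(x,y;Z_0,\dots,Z_{n-1})$ such that for every nonempty $G\in\mathcal{C}$ there are vertex sets $P_i$ with $\{(a,b):\lfloor G\rfloor\models\varphi(a,b;\bar P)\}$ a linear order on the vertices. A graph with ports in $[k]$ is a graph with $\pi:V\to[k]$; for $R\subseteq[k]\times[k]$, $G\otimes_R H$ is the disjoint union plus all edges $\{x,y\}$ with $x,y$ in different operands, labels $a,b$ with $(a,b)\in R$ (associative, commutative); $\mathrm{Del}$ deletes labels; $\mathrm{Cut}(G,k)$ is the maximal $n$ with $G\cong\mathrm{Del}(H_0\otimes_R\cdots\otimes_R H_{n-1})$ for nonempty $H_i$ with ports in $[k]$ and some $R$. $\mathcal{C}$ has $\mathsf{CUT}$ if there is $f$ with $\mathrm{Cut}(G,k)\le f(k)$ for all $G\in\mathcal{C}$, $k$.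 *)

(* Defs.v *)
From HB Require Import structures.
From mathcomp Require Import all_boot.
Set Implicit Arguments. Unset Strict Implicit. Unset Printing Implicit Defensive.

Record graph := Graph {
  vert : finType;
  adj : rel vert;
  adj_sym : symmetric adj;
  adj_irr : irreflexive adj }.

Definition iso (G H : graph) : Prop :=
  exists f : vert G -> vert H, bijective f /\ forall x y, adj (f x) (f y) = adj x y.

Definition nonempty_graph (G : graph) : Prop := 0 < #|vert G|.

Definition gempty : graph :=
  @Graph void (fun _ _ => false) (fun _ _ => erefl) (fun _ => erefl).
Definition gK1 : graph :=
  @Graph unit (fun _ _ => false) (fun _ _ => erefl) (fun _ => erefl).

Definition sum_adj (G H : graph) (cross : vert G -> vert H -> bool)
  : rel (vert G + vert H) :=
  fun u v => match u, v with
             | inl x, inl y => adj x y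
             | inr x, inr y => adj x y
             | inl x, inr y => cross x y
             | inr x, inl y => cross y x
             end.

Lemma sum_adj_sym G H cross : symmetric (@sum_adj G H cross).
Proof. by case=> x [] y //=; apply: adj_sym. Qed.

Lemma sum_adj_irr G H cross : irreflexive (@sum_adj G H cross).
Proof. by case=> x /=; apply: adj_irr. Qed.

Definition gsum (G H : graph) (cross : vert G -> vert H -> bool) : graph :=
  @Graph (vert G + vert H)%type (sum_adj cross) (@sum_adj_sym G H cross)
         (@sum_adj_irr G H cross).

Definition gunion (G H : graph) : graph := gsum (fun (_ : vert G) (_ : vert H) => false).
Definition gjoin (G H : graph) : graph := gsum (fun (_ : vert G) (_ : vert H) => true).

Inductive cotree : Type :=
| CLeaf : cotree
| CUnion : seq cotree -> cotree
| CJoin : seq cotree -> cotree.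

Definition is_union (t : cotree) : bool := if t is CUnion _ then true else false.
Definition is_join (t : cotree) : bool := if t is CJoin _ then true else false.

Fixpoint valid_cotree (t : cotree) : bool :=
  match t with
  | CLeaf => true
  | CUnion ts => [&& 2 <= size ts, all (fun s => ~~ is_union s) ts & all valid_cotree ts]
  | CJoin ts => [&& 2 <= size ts, all (fun s => ~~ is_join s) ts & all valid_cotree ts]
  end.

Fixpoint den (t : cotree) : graph :=
  match t with
  | CLeaf => gK1
  | CUnion ts => foldr gunion gempty (map den ts)
  | CJoin ts => foldr gjoin gempty (map den ts)
  end.

Fixpoint outdeg (t : cotree) : nat :=
  match t with
  | CLeaf => 0
  | CUnion ts => foldr maxn (size ts) (map outdeg ts)
  | CJoin ts => foldr maxn (size ts) (map outdeg ts)
  end.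

Definition is_cograph (G : graph) : Prop := exists t, valid_cotree t /\ iso G (den t).

Definition cotree_bounded (C : graph -> Prop) : Prop :=
  exists d : nat, forall G, C G ->
    forall t, valid_cotree t -> iso G (den t) -> outdeg t <= d.

Record pgraph (k : nat) := PGraph { pg : graph; port : vert pg -> 'I_k }.

Definition pprod (k : nat) (R : rel 'I_k) (H1 H2 : pgraph k) : pgraph k :=
  @PGraph k
    (gsum (fun (x : vert (pg H1)) (y : vert (pg H2)) =>
             R (port x) (port y) || R (port y) (port x)))
    (fun v => match v with inl x => port x | inr y => port y end).

Definition pempty (k : nat) : pgraph k :=
  @PGraph k gempty (fun v : void => match v with end).

(** Del = forgetting the ports, i.e. [pg].
    [cut_decomp G k n]: G is isomorphic to Del(H_0 (x)_R ... (x)_R H_{n-1})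
    for some nonempty H_i with ports in [k] and some R. *)
Definition cut_decomp (G : graph) (k n : nat) : Prop :=
  exists (R : rel 'I_k) (Hs : seq (pgraph k)),
    size Hs = n /\ (forall i, i < n -> nonempty_graph (pg (nth (pempty k) Hs i))) /\
    iso G (pg (foldr (pprod R) (pempty k) Hs)).

(** CUT: Cut(G,k) (the maximal such n) is bounded by f(k) *)
Definition has_CUT (C : graph -> Prop) : Prop :=
  exists f : nat -> nat, forall G, C G -> forall k n, cut_decomp G k n -> n <= f k.

Inductive mso : Type :=
| MEq : nat -> nat -> mso
| MEdge : nat -> nat -> mso
| MIn : nat -> nat -> mso
| MNot : mso -> mso
| MAnd : mso -> mso -> mso
| MOr : mso -> mso -> mso
| MEx : nat -> mso -> mso
| MAll : nat -> mso -> mso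
| MExS : nat -> mso -> mso
| MAllS : nat -> mso -> mso.

Fixpoint fo_fv (f : mso) : seq nat :=
  match f with
  | MEq i j | MEdge i j => [:: i; j]
  | MIn i _ => [:: i]
  | MNot g => fo_fv g
  | MAnd g h | MOr g h => fo_fv g ++ fo_fv h
  | MEx i g | MAll i g => filter (predC1 i) (fo_fv g)
  | MExS _ g | MAllS _ g => fo_fv g
  end.

Fixpoint so_fv (f : mso) : seq nat :=
  match f with
  | MEq _ _ | MEdge _ _ => [::]
  | MIn _ X => [:: X]
  | MNot g => so_fv g
  | MAnd g h | MOr g h => so_fv g ++ so_fv h
  | MEx _ g | MAll _ g => so_fv g
  | MExS X g | MAllS X g => filter (predC1 X) (so_fv g)
  end.

Definition upd (T : Type) (s : nat -> T) (i : nat) (v : T) : nat -> T :=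
  fun j => if j == i then v else s j.

Fixpoint sat (G : graph) (nu : nat -> vert G) (mu : nat -> {set vert G}) (f : mso)
  : Prop :=
  match f with
  | MEq i j => nu i = nu j
  | MEdge i j => adj (nu i) (nu j)
  | MIn i X => nu i \in mu X
  | MNot g => ~ sat nu mu g
  | MAnd g h => sat nu mu g /\ sat nu mu h
  | MOr g h => sat nu mu g \/ sat nu mu h
  | MEx i g => exists v : vert G, sat (upd nu i v) mu g
  | MAll i g => forall v : vert G, sat (upd nu i v) mu g
  | MExS X g => exists A : {set vert G}, sat nu (upd mu X A) g
  | MAllS X g => forall A : {set vert G}, sat nu (upd mu X A) g
  end.

Definition linear_order (T : Type) (r : T -> T -> Prop) : Prop :=
  (forall a, r a a) /\ (forall a b, r a b -> r b a -> a = b) /\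
  (forall a b c, r a b -> r b c -> r a c) /\ (forall a b, r a b \/ r b a).

(** MSO_1-orderable: a formula phi(x,y; Z_0..Z_{n-1}), with x = FO variable 0,
    y = FO variable 1 and Z_i = set variable i, such that for every nonempty G in C
    there are P_0..P_{n-1} making phi define a linear order on the vertices. *)
Definition mso_orderable (C : graph -> Prop) : Prop :=
  exists (phi : mso) (n : nat),
    {subset fo_fv phi <= [:: 0; 1]} /\ all (fun X => X < n) (so_fv phi) /\
    forall G, C G -> nonempty_graph G ->
      exists P : seq {set vert G}, size P = n /\
        linear_order (fun a b : vert G =>
          sat (fun i => if i == 0 then a else b) (fun X => nth set0 P X) phi).

(* Main.v *)
(** (1) => (2): cut a graph into parts [H_0, ..., H_{n-1}] glued along ports.  By the
    composition method the truth of a formula depends only on the types of the parts, and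
    these range over a finite set determined by the formula and [k].  If [n] exceeds its
    size, two parts with chosen vertices [a] and [b] have the same type; exchanging them
    shows [phi(a,b) <-> phi(b,a)], which no linear order satisfies.

    (2) => (3): the vertices below a node of the cotree form a module, so three ports
    suffice to cut the graph into as many parts as the node has children.

    (3) => (1): it suffices to label the vertices so that distinct siblings [A], [B] of the
    cotree are told apart by some definable property.  The property used is "the set [W j]
    contains a maximal clique of the subgraph induced on [A]", which behaves like an
    AND/OR formula along the cotree.  Two vertices are compared by means of the children
    of their least common ancestor in which they lie, and these children are definable as
    largest (co-)connected modules containing one vertex and not the other. *)
Require Import Defs.
From HB Require Import structures.
From mathcomp Require Import all_boot.
From Stdlib Require Import Classical.
Set Implicit Arguments. Unset Strict Implicit. Unset Printing Implicit Defensive.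

(** * Cut decompositions *)

Definition emb (H G : graph) (f : vert H -> vert G) : Prop :=
  injective f /\ forall x y, adj (f x) (f y) = adj x y.

Section FoldedProduct.
Variables (k : nat) (R : rel 'I_k).
Implicit Type Hs : seq (pgraph k).

Notation pfold Hs := (foldr (pprod R) (pempty k) Hs).

Fixpoint operand Hs : vert (pg (pfold Hs)) -> nat :=
  match Hs with
  | [::] => fun=> 0
  | _ :: Hs' => fun v => match v with inl _ => 0 | inr w => (operand w).+1 end
  end.

Lemma operand_lt Hs (v : vert (pg (pfold Hs))) : operand v < size Hs.
Proof. by elim: Hs v => [[]|H Hs IH] //= [x|w] //=; rewrite ltnS. Qed.

Lemma operand_adj Hs (u v : vert (pg (pfold Hs))) :
  operand u != operand v -> adj u v = R (port u) (port v) || R (port v) (port u).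
Proof.
elim: Hs u v => [[]|H Hs IH] //= [x|x] [y|y] //=; last by rewrite eqSS => /IH.
by rewrite orbC.
Qed.

Lemma operand_emb Hs i : i < size Hs ->
  exists e : vert (pg (nth (pempty k) Hs i)) -> vert (pg (pfold Hs)),
    emb e /\ forall v, operand v = i <-> exists w, v = e w.
Proof.
elim: Hs i => [|H Hs IH] [|i] //= ltiH.
  exists inl; split; first by split=> // x y [].
  case=> [x|y] /=; last by split=> // -[].
  by split=> // _; exists x.
have [e [[inj_e adj_e] imE]] := IH i ltiH.
exists (inr \o e); split; first by split=> //= x y [/inj_e].
case=> [x|y] /=; first by split=> // -[].
split=> [[/imE[w ->]]|[w [->]]]; first by exists w.
by congr _.+1; apply/imE; exists w.
Qed.

End FoldedProduct.

Definition part (G : graph) (c : vert G -> nat) (i : nat) : {set vert G} :=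
  [set x | c x == i].

(** A decomposition seen from inside [G]: indices and ports become functions on its vertices, which
    avoids iterated sum types. [R] is symmetric because [pprod] reads it in both directions. *)
Definition cut_parts (G : graph) (k n : nat) : Prop :=
  exists (R : rel 'I_k) (c : vert G -> nat) (pt : vert G -> 'I_k),
    [/\ symmetric R, forall x, c x < n, forall i, i < n -> exists x, c x = i &
        forall x y, c x != c y -> adj x y = R (pt x) (pt y)].

Lemma cut_decomp_parts G k n : cut_decomp G k n -> cut_parts G k n.
Proof.
case=> R [Hs [<- [ne [f [[g fK gK] adj_f]]]]].
exists (fun a b => R a b || R b a), (fun x => operand (f x)), (fun x => port (f x)).
split=> [a b|x|i lti|x y /operand_adj <-]; first by rewrite orbC.
- exact: operand_lt.
- have [e [_ imE]] := operand_emb R lti.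
  have /card_gt0P[w _] := ne i lti.
  by exists (g (e w)); rewrite gK; apply/imE; exists w.
- by rewrite adj_f.
Qed.

Section InducedSubgraph.
Variables (G : graph) (S : {set vert G}).

Definition ind_adj : rel {x | x \in S} := fun x y => adj (val x) (val y).

Lemma ind_adj_sym : symmetric ind_adj.
Proof. by move=> x y; apply: adj_sym. Qed.

Lemma ind_adj_irr : irreflexive ind_adj.
Proof. by move=> x; apply: adj_irr. Qed.

Definition induced : graph := Graph ind_adj_sym ind_adj_irr.

End InducedSubgraph.

Lemma inj_surj_bij (A B : finType) (f : A -> B) :
  injective f -> (forall y, exists x, y = f x) -> bijective f.
Proof.
move=> inj_f surj_f; apply: inj_card_bij => //.
rewrite -(card_codom inj_f).
by apply: subset_leq_card; apply/subsetP => y _; have [x ->] := surj_f y; apply: codom_f.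
Qed.

Lemma iso_sym G H : iso G H -> iso H G.
Proof.
case=> f [[g fK gK] adj_f]; exists g; split; first by exists f.
by move=> x y; rewrite -adj_f !gK.
Qed.

Lemma cut_parts_decomp G k n : cut_parts G k n -> cut_decomp G k n.
Proof.
case=> R [c [pt [symR ltc surc adjc]]].
pose H i := @PGraph k (induced (part c i)) (fun x => pt (val x)).
exists R, [seq H i | i <- iota 0 n]; split; first by rewrite size_map size_iota.
split.
  move=> i lti; rewrite (nth_map 0) ?size_iota // nth_iota // add0n.
  have [x cx] := surc i lti.
  have xi : x \in part c i by rewrite inE cx.
  by apply/card_gt0P; exists (exist _ x xi).
apply: iso_sym.
(* The induction runs over any list of distinct indices; the image consists of the vertices whose
   index is listed. *)
have [f [inj_f adj_f pt_f imf]] :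
  exists f : vert (pg (foldr (pprod R) (pempty k) [seq H i | i <- iota 0 n])) -> vert G,
    [/\ injective f, forall x y, adj (f x) (f y) = adj x y,
        forall x, pt (f x) = port x & forall y, c y \in iota 0 n <-> exists x, y = f x].
  elim: (iota 0 n) (iota_uniq 0 n) => [_|i s IH] /=.
    exists (fun v : void => match v with end); split; [by case|by case|by case|].
    by move=> y; split=> // -[[]].
  case/andP=> nis /IH[f [inj_f adj_f pt_f imf]].
  have cf w : c (f w) != i.
    apply: contraNneq nis => <-; by apply/imf; exists w.
  have cv (x : vert (pg (H i))) : c (val x) = i.
    by have := valP x; rewrite inE => /eqP.
  exists (fun v => match v with inl x => val x | inr w => f w end); split.
  - case=> [x|x] [y|y] //=.
    + by move/val_inj->.
    + by move=> E; have := cf y; rewrite -E cv eqxx.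
    + by move=> E; have := cf x; rewrite E cv eqxx.
    + by move/inj_f->.
  - case=> [x|x] [y|y] //=.
    + by rewrite adjc ?cv 1?eq_sym ?cf // pt_f symR orbb.
    + by rewrite adjc ?cv ?cf // pt_f symR orbb.
  - by case=> [x|w] /=.
  - move=> y; rewrite inE; split.
      case/orP=> [/eqP cy|/imf[w ->]]; last by exists (inr w).
      have yi : y \in part c i by rewrite inE cy.
      by exists (inl (exist _ y yi)).
    case=> [[x ->|w ->]]; first by rewrite cv eqxx.
    by apply/orP; right; apply/imf; exists w.
exists f; split=> //; apply: inj_surj_bij => // y.
by apply/imf; rewrite mem_iota add0n leq0n ltc.
Qed.

(** * Composition of types *)

(** Hintikka types of one part, finite for given formula and [k]. An edge atom also records ports,
    which decide adjacency across parts. *)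
Fixpoint mso_type (k : nat) (phi : mso) : finType :=
  match phi with
  | MEq _ _ | MIn _ _ => bool
  | MEdge _ _ => (bool * ({set 'I_k} * {set 'I_k}))%type
  | MNot g => mso_type k g
  | MAnd g h | MOr g h => (mso_type k g * mso_type k h)%type
  | MEx _ g | MAll _ g => {set bool * bool * mso_type k g}
  | MExS _ g | MAllS _ g => {set mso_type k g}
  end.

Section Types.
Variables (G : graph) (k : nat) (pt : vert G -> 'I_k).
Implicit Types (U A : {set vert G}) (nu mu : nat -> {set vert G}).

(* Only [U :&: nu i] and [U :&: mu X] matter: an element variable is interpreted by a set
   that is a singleton in the part containing its value and empty in all others.  A move
   for such a variable records which of the two cases occurs, since the information is
   lost when the variable is bound again. *)
Fixpoint mtype phi U nu mu : mso_type k phi :=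
  match phi return mso_type k phi with
  | MEq i j => U :&: nu i :&: (U :&: nu j) != set0
  | MEdge i j => ([exists x in U :&: nu i, exists y in U :&: nu j, adj x y],
                  (pt @: (U :&: nu i), pt @: (U :&: nu j)))
  | MIn i X => U :&: nu i :&: (U :&: mu X) != set0
  | MNot g => mtype g U nu mu
  | MAnd g h => (mtype g U nu mu, mtype h U nu mu)
  | MOr g h => (mtype g U nu mu, mtype h U nu mu)
  | MEx i g => [set (U :&: A == set0, #|U :&: A| == 1, mtype g U (upd nu i A) mu)
               | A : {set vert G}]
  | MAll i g => [set (U :&: A == set0, #|U :&: A| == 1, mtype g U (upd nu i A) mu)
               | A : {set vert G}]
  | MExS X g => [set mtype g U nu (upd mu X A) | A : {set vert G}]
  | MAllS X g => [set mtype g U nu (upd mu X A) | A : {set vert G}]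
  end.

Lemma upd_local U nu nu' i A A' : U :&: A = U :&: A' ->
  (forall j, U :&: nu j = U :&: nu' j) ->
  forall j, U :&: upd nu i A j = U :&: upd nu' i A' j.
Proof. by move=> EA E j; rewrite /upd; case: ifP. Qed.

Lemma mtype_local phi U nu nu' mu mu' :
  (forall i, U :&: nu i = U :&: nu' i) -> (forall X, U :&: mu X = U :&: mu' X) ->
  mtype phi U nu mu = mtype phi U nu' mu'.
Proof.
elim: phi nu nu' mu mu' => [i j|i j|i X|g IH|g IHg h IHh|g IHg h IHh|i g IH|i g IH|X g IH|X g IH]
  nu nu' mu mu' En Em /=; rewrite ?En ?Em //.
- exact: IH.
- by congr (_, _); [apply: IHg|apply: IHh].
- by congr (_, _); [apply: IHg|apply: IHh].
- by apply: eq_imset => A; congr (_, _); apply: IH => //; apply: upd_local.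
- by apply: eq_imset => A; congr (_, _); apply: IH => //; apply: upd_local.
- by apply: eq_imset => A; apply: IH => //; apply: upd_local.
- by apply: eq_imset => A; apply: IH => //; apply: upd_local.
Qed.

End Types.

(** * Exchange of parts with equal types *)

Section Composition.
Variables (G : graph) (k : nat) (R : rel 'I_k) (pt : vert G -> 'I_k).
Variables (K : finType) (c : vert G -> K) (s : K -> K).
Hypothesis sK : involutive s.
Hypothesis adjc : forall x y, c x != c y -> adj x y = R (pt x) (pt y).

Let V p := [set x | c x == p].
Let sing (nu : nat -> vert G) i : {set vert G} := [set nu i].

(** The invariant of a back-and-forth game in which part [p] on the left is matched with part [s p]
    on the right. *)
Definition swap_equiv phi (nu nu' : nat -> vert G) (mu mu' : nat -> {set vert G}) :=
  forall p, mtype pt phi (V p) (sing nu) mu = mtype pt phi (V (s p)) (sing nu') mu'.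

Lemma swap_equiv_sym phi nu nu' mu mu' :
  swap_equiv phi nu nu' mu mu' -> swap_equiv phi nu' nu mu' mu.
Proof. by move=> E p; rewrite -{1}(sK p) -E. Qed.

Lemma V_sing p x : V p :&: [set x] = if c x == p then [set x] else set0.
Proof.
apply/setP=> y; rewrite !inE; case: ifP => cx; rewrite !inE; case: (eqVneq y x) => [->|]; rewrite ?andbF ?cx //.
Qed.

(** The parts are disjoint, so a set can be prescribed in each of them independently. *)
Lemma glue_parts (B : K -> {set vert G}) :
  exists A, forall p, V (s p) :&: A = V (s p) :&: B p.
Proof.
exists [set x | x \in B (s (c x))] => p; apply/setP=> x; rewrite !inE.
by case: eqP => // ->; rewrite sK.
Qed.

Lemma swap_equiv_setmove g X nu nu' mu mu' A :
  (forall p, [set mtype pt g (V p) (sing nu) (upd mu X A) | A : {set vert G}] =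
             [set mtype pt g (V (s p)) (sing nu') (upd mu' X A) | A : {set vert G}]) ->
  exists A', swap_equiv g nu nu' (upd mu X A) (upd mu' X A').
Proof.
move=> E.
have /fin_all_exists[B EB] p : exists B,
    mtype pt g (V p) (sing nu) (upd mu X A) = mtype pt g (V (s p)) (sing nu') (upd mu' X B).
  have : mtype pt g (V p) (sing nu) (upd mu X A) \in
      [set mtype pt g (V p) (sing nu) (upd mu X A) | A : {set vert G}] by apply: imset_f.
  by rewrite E => /imsetP[B _ ->]; exists B.
have [A' EA'] := glue_parts B; exists A' => p.
by rewrite EB; apply: mtype_local => //; apply: upd_local => //; rewrite EA'.
Qed.

Lemma sing_upd nu i v U j :
  U :&: upd (sing nu) i [set v] j = U :&: sing (upd nu i v) j.
Proof. by rewrite /upd /sing; case: ifP. Qed.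

Lemma swap_equiv_pointmove g i nu nu' mu mu' v :
  (forall p, [set (V p :&: A == set0, #|V p :&: A| == 1,
                   mtype pt g (V p) (upd (sing nu) i A) mu) | A : {set vert G}] =
             [set (V (s p) :&: A == set0, #|V (s p) :&: A| == 1,
                   mtype pt g (V (s p)) (upd (sing nu') i A) mu') | A : {set vert G}]) ->
  exists v', swap_equiv g (upd nu i v) (upd nu' i v') mu mu'.
Proof.
move=> E.
have /fin_all_exists[B EB] p : exists B,
    [/\ (V p :&: [set v] == set0) = (V (s p) :&: B == set0),
        (#|V p :&: [set v]| == 1) = (#|V (s p) :&: B| == 1) &
     mtype pt g (V p) (upd (sing nu) i [set v]) mu
       = mtype pt g (V (s p)) (upd (sing nu') i B) mu'].
  have : (V p :&: [set v] == set0, #|V p :&: [set v]| == 1,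
          mtype pt g (V p) (upd (sing nu) i [set v]) mu) \in
      [set (V p :&: A == set0, #|V p :&: A| == 1,
                   mtype pt g (V p) (upd (sing nu) i A) mu) | A : {set vert G}].
    by apply/imsetP; exists [set v].
  by rewrite E => /imsetP[B _ [-> -> ->]]; exists B.
(* The cardinality flag makes the answer in the part matched with that of [v] a singleton, hence a
   vertex [v']; the emptiness flag keeps all other answers empty. *)
have [_ +  _] := EB (c v); rewrite V_sing eqxx cards1 eqxx => /esym/cards1P[v' Ev'].
exists v' => p; have [E0 _ Et] := EB p.
rewrite -(mtype_local pt g (sing_upd nu i v (V p)) (fun=> erefl)) Et.
apply: mtype_local => // j; rewrite /sing /upd; case: ifP => // _.
have [<-|nep] := eqVneq (c v) p.
  rewrite Ev'; apply/setP=> y; rewrite !inE; case: (eqVneq y v') => [->|]; rewrite ?andbF //.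
  have : v' \in V (s (c v)) :&: B (c v) by rewrite Ev' set11.
  by rewrite !inE => /andP[->].
have /eqP-> : V (s p) :&: B p == set0 by rewrite -E0 V_sing (negPf nep).
have : v' \in V (s (c v)) :&: B (c v) by rewrite Ev' set11.
rewrite !inE => /andP[/eqP cv' _].
by rewrite V_sing cv' (can_eq sK) (negPf nep).
Qed.

Lemma meet_V p x (A : {set vert G}) :
  (V p :&: [set x] :&: (V p :&: A) != set0) = (c x == p) && (x \in A).
Proof.
rewrite V_sing; case: ifP => cx /=; last by rewrite set0I eqxx.
apply/set0Pn/idP => [[y]|xA]; first by rewrite !inE => /and3P[/eqP->].
by exists x; rewrite !inE eqxx cx.
Qed.

(** An empty set has no ports, so equal port sets also force [q] into part [s p]. *)
Lemma pt_V p x q : c x == p -> pt @: (V p :&: [set x]) = pt @: (V (s p) :&: [set q]) ->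
  c q = s p /\ pt q = pt x.
Proof.
rewrite !V_sing => ->; rewrite imset_set1.
case: ifP => [/eqP-> /esym|_ /setP/(_ (pt x))]; last by rewrite imset0 !inE eqxx.
by rewrite imset_set1 => /set1_inj.
Qed.

Lemma swap_equiv_sat phi nu nu' mu mu' :
  swap_equiv phi nu nu' mu mu' -> sat nu mu phi <-> sat nu' mu' phi.
Proof.
(* By symmetry of [swap_equiv] one implication per formula is enough, while the induction hypothesis
   stays an equivalence, as negation requires. *)
suff imp psi : (forall nu nu' mu mu', swap_equiv psi nu nu' mu mu' ->
    sat nu mu psi -> sat nu' mu' psi) -> forall nu nu' mu mu',
    swap_equiv psi nu nu' mu mu' -> (sat nu mu psi <-> sat nu' mu' psi).
  move: nu nu' mu mu'; elim: phi => [i j|i j|i X|g IH|g IHg h IHh|g IHg h IHh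
      |i g IH|i g IH|X g IH|X g IH]; apply: imp => nu nu' mu mu' E /=.
  - move=> Eij; have := E (c (nu i)); rewrite /= !meet_V /sing !inE Eij !eqxx /=.
    by move/esym/andP=> [_ /eqP].
  - have [/= _ Ei _] := E (c (nu i)); have [/= _ _ Ej] := E (c (nu j)).
    have [ci pi] := pt_V (eqxx _) Ei; have [cj pj] := pt_V (eqxx _) Ej.
    (* Across parts the ports decide adjacency; within one part the Boolean component of the type
       does. *)
    have [cij|cij] := eqVneq (c (nu i)) (c (nu j)); last first.
      by rewrite !adjc ?ci ?cj ?(can_eq sK) // pi pj.
    have [/= Ea _ _] := E (c (nu i)) => aij; move: Ea.
    rewrite /sing !V_sing ci cj cij !eqxx.
    have -> : [exists x in [set nu i], exists y in [set nu j], adj x y].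
      by apply/exists_inP; exists (nu i); rewrite ?set11 //; apply/exists_inP; exists (nu j);
        rewrite ?set11.
    by case/esym/exists_inP=> x /set1P-> /exists_inP[y /set1P->].
  - move=> Ei; have := E (c (nu i)); rewrite /= !meet_V Ei eqxx.
    by move/esym/andP=> [].
  - by move=> ng /(IH _ _ _ _ E).
  - case=> /IHg Hg /IHh Hh; split; [apply: Hg|apply: Hh] => p; by have [] := E p.
  - case=> [/IHg Hg|/IHh Hh]; [left; apply: Hg|right; apply: Hh] => p; by have [] := E p.
  - case=> v sv; have [v' /IH Ev] := swap_equiv_pointmove v E.
    by exists v'; apply/Ev.
  - move=> sv v'; have [v /IH Ev] := swap_equiv_pointmove v' (swap_equiv_sym E).
    by apply/Ev.
  - case=> A sA; have [A' /IH EA] := swap_equiv_setmove A E.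
    by exists A'; apply/EA.
  - move=> sA A'; have [A /IH EA] := swap_equiv_setmove A' (swap_equiv_sym E).
    by apply/EA.
move=> H nu1 nu1' mu1 mu1' E; split; first exact: H.
by apply: H; apply: swap_equiv_sym.
Qed.

End Composition.

Lemma orderable_CUT C : mso_orderable C -> has_CUT C.
Proof.
case=> phi [m [_ [_ ordC]]].
exists (fun k => #|{: mso_type k phi * mso_type k phi}|) => G CG k n /cut_decomp_parts.
case=> R [c [pt [symR ltc surc adjc]]].
case: n => // n in ltc surc *.
have [x0 _] := surc 0 isT.
have [|P [_ [_ [anti [_ total]]]]] := ordC G CG; first by apply/card_gt0P; exists x0.
pose mu X := nth set0 P X.
pose c' x : 'I_n.+1 := Ordinal (ltc x).
have /fin_all_exists[a ca] (p : 'I_n.+1) : exists x, c' x = p.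
  by have [x cx] := surc p (ltn_ord p); exists x; apply: val_inj.
pose V p := [set x | c' x == p].
(* The types of part [p] when it contains only the first argument, and only the second. The bound is
   the number of such pairs of types. *)
pose F p := (mtype pt phi (V p) (fun i => if i == 0 then [set a p] else set0) mu,
             mtype pt phi (V p) (fun i => if i == 0 then set0 else [set a p]) mu).
case: (leqP n.+1 #|{: mso_type k phi * mso_type k phi}|) => // small.
have /injectivePn[p [p' np [E1 E2]]] : ~~ injectiveb F.
  apply/injectiveP=> /card_codom; rewrite card_ord => EF.
  by have := max_card (mem (codom F)); rewrite EF leqNgt small.
pose s r := if r == p then p' else if r == p' then p else r.
have sK : involutive s.
  move=> r; rewrite /s; case: (eqVneq r p) => [->|rp].
    by rewrite eq_sym (negPf np) eqxx.
  by case: (eqVneq r p') => [->|rp']; rewrite ?eqxx // (negPf rp) (negPf rp').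
have adjc' x y : c' x != c' y -> adj x y = R (pt x) (pt y) by exact: adjc.
pose nu (x y : vert G) i := if i == 0 then x else y.
have V1 r q : V r :&: [set a q] = if q == r then [set a q] else set0.
  by rewrite V_sing ca.
(* Part [p] sees only the first argument and [p'] only the second; the other parts see neither and
   are fixed by [s]. *)
have E : swap_equiv pt c' s phi (nu (a p) (a p')) (nu (a p') (a p)) mu mu.
  move=> r; rewrite -/(V r) -/(V (s r)) /s.
  have [->|rp] := eqVneq r p.
    transitivity (F p).1.
      by apply: mtype_local => // -[|i] //=; rewrite /nu /= V1 eq_sym (negPf np) setI0.
    rewrite /F E1; apply: mtype_local => // -[|i] //=.
    by rewrite /nu /= V1 (negPf np) setI0.
  have [->|rp'] := eqVneq r p'.
    transitivity (F p').2.
      by apply: mtype_local => // -[|i] //=; rewrite /nu /= V1 (negPf np) setI0.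
    rewrite /F -E2; apply: mtype_local => // -[|i] //=.
    by rewrite /nu /= V1 eq_sym (negPf np) setI0.
  by apply: mtype_local => // -[|i] //=; rewrite /nu /= !V1 !(eq_sym _ r) (negPf rp) (negPf rp').
have /(_ R) [] // := swap_equiv_sat sK _ E => S1 S2.
suff /(f_equal c') : a p = a p' by rewrite !ca => /eqP; rewrite (negPf np).
by case: (total (a p) (a p')) => S; apply: anti => //; [apply: S1|apply: S2].
Qed.

(** * Realized cotrees *)

(** [b] is the adjacency between different children, so unions and joins are treated together. *)
Definition cnode (b : bool) (ts : seq cotree) : cotree :=
  if b then CJoin ts else CUnion ts.

Definition is_node (b : bool) (t : cotree) : bool :=
  if b then is_join t else is_union t.

Section CotreeInduction.
Variable P : cotree -> Prop.
Hypothesis P_leaf : P CLeaf.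
Hypothesis P_node : forall b ts, (forall i, i < size ts -> P (nth CLeaf ts i)) -> P (cnode b ts).

Fixpoint cotree_nested_ind (t : cotree) : P t :=
  let fix forest (ts : seq cotree) : forall i, i < size ts -> P (nth CLeaf ts i) :=
    match ts return forall i, i < size ts -> P (nth CLeaf ts i) with
    | [::] => fun i lti => False_ind _ (Bool.diff_false_true lti)
    | t :: ts' => fun i => match i return i < size (t :: ts') -> P (nth CLeaf (t :: ts') i) with
                           | 0 => fun=> cotree_nested_ind t
                           | i'.+1 => forest ts' i'
                           end
    end in
  match t with
  | CLeaf => P_leaf
  | CUnion ts => @P_node false ts (forest ts)
  | CJoin ts => @P_node true ts (forest ts)
  end.

End CotreeInduction.

Lemma valid_cnode b ts : valid_cotree (cnode b ts) ->
  2 <= size ts /\ forall i, i < size ts ->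
    ~~ is_node b (nth CLeaf ts i) /\ valid_cotree (nth CLeaf ts i).
Proof.
by case: b => /= /and3P[sz /all_nthP nb /all_nthP vb]; split=> // i lti; split; auto.
Qed.

Lemma outdeg_cnode b ts :
  outdeg (cnode b ts) = foldr maxn (size ts) (map outdeg ts).
Proof. by case: b. Qed.

Lemma outdeg_node_size b ts : size ts <= outdeg (cnode b ts).
Proof.
rewrite outdeg_cnode; move: (size ts) => n.
by elim: ts => //= t ts IH; rewrite leq_max IH orbT.
Qed.

Lemma outdeg_child b ts i : i < size ts -> outdeg (nth CLeaf ts i) <= outdeg (cnode b ts).
Proof.
rewrite outdeg_cnode; move: {2}(size ts) => n.
by elim: ts i => //= t ts IH [|i] lti; rewrite leq_max ?leqnn ?IH ?orbT.
Qed.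

Lemma outdeg_node_attained b ts : outdeg (cnode b ts) = size ts \/
  exists2 i, i < size ts & outdeg (cnode b ts) = outdeg (nth CLeaf ts i).
Proof.
rewrite outdeg_cnode; move: {1 2 4}(size ts) => n.
elim: ts => [|t ts IH] /=; first by left.
case: leqP => _; last by right; exists 0.
by case: IH => [|[i lti E]]; [left|right; exists i.+1].
Qed.

Definition child (G : graph) (S : {set vert G}) (c : vert G -> nat) (i : nat) : {set vert G} :=
  [set x in S | c x == i].

(* [realizes t S]: the subgraph induced on [S] has cotree [t]; at every node the
   function [c] sends a vertex to the index of the child it lies below. *)
Inductive realizes (G : graph) : cotree -> {set vert G} -> Prop :=
| RealizesLeaf x : realizes CLeaf [set x]
| RealizesNode b ts (S : {set vert G}) (c : vert G -> nat) :
    {in S, forall x, c x < size ts} ->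
    {in S &, forall x y, c x != c y -> adj x y = b} ->
    (forall i, i < size ts -> realizes (nth CLeaf ts i) (child S c i)) ->
    realizes (cnode b ts) S.

Definition oneport (G : graph) : pgraph 1 := @PGraph 1 G (fun=> ord0).

(** Both operations are products with a single port, so the facts about [operand] apply to
    cotrees. *)
Lemma den_cnode b ts : den (cnode b ts) =
  pg (foldr (pprod (fun _ _ : 'I_1 => b)) (pempty 1) [seq oneport (den t) | t <- ts]).
Proof.
by case: b => /=; elim: ts => //= t ts ->.
Qed.

Lemma den_realizes t G (f : vert (den t) -> vert G) : emb f -> realizes t (f @: setT).
Proof.
elim/cotree_nested_ind: t f => [|b ts IH] f.
  move=> _; have -> : f @: setT = [set f tt]; last by constructor.
  by apply/setP=> y; rewrite inE; apply/imsetP/eqP=> [[[]]|->] //; exists tt.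
move: f; rewrite den_cnode; set Hs := map _ _ => f [inj_f adj_f].
have szH : size Hs = size ts by rewrite size_map.
(* The operand index carried along [f]; the default 0 is taken only outside its image. *)
pose c (x : vert G) : nat := if [pick v | f v == x] is Some v then operand v else 0.
have cf v : c (f v) = operand v.
  by rewrite /c; case: pickP => [w /eqP/inj_f->|/(_ v)]; rewrite ?eqxx.
apply: (@RealizesNode _ _ _ _ c).
- by move=> _ /imsetP[v _ ->]; rewrite cf -szH operand_lt.
- move=> _ _ /imsetP[v _ ->] /imsetP[w _ ->]; rewrite !cf adj_f => /operand_adj ->.
  by rewrite orbb.
move=> i lti; have := lti; rewrite -szH => /(operand_emb (fun _ _ => b)).
rewrite (nth_map CLeaf) // => -[e [[inj_e adj_e] imE]].
have -> : child (f @: setT) c i = (f \o e) @: setT.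
  apply/setP=> y; rewrite !inE; apply/andP/imsetP.
    by case=> /imsetP[v _ ->]; rewrite cf => /eqP/imE[w ->]; exists w.
  by case=> w _ -> /=; rewrite cf imset_f //; split=> //; apply/eqP/imE; exists w.
apply: IH => //; split; first exact: inj_comp.
by move=> x y; rewrite /= adj_f adj_e.
Qed.

Lemma iso_realizes G t : iso G (den t) -> realizes t [set: vert G].
Proof.
case/iso_sym=> f [[g fK gK] adj_f].
have <- : f @: setT = setT.
  by apply/setP=> y; rewrite !inE; apply/imsetP; exists (g y); rewrite ?gK.
by apply: den_realizes; split=> //; apply: can_inj fK.
Qed.

Lemma realizes_neq0 G t (S : {set vert G}) :
  realizes t S -> valid_cotree t -> exists x, x \in S.
Proof.
elim=> [x _|b ts {}S c _ _ _ IH /valid_cnode[sz vts]]; first by exists x; rewrite set11.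
have lt0 : 0 < size ts by apply: leq_trans sz.
by have [x] := IH _ lt0 (vts _ lt0).2; rewrite inE => /andP[]; exists x.
Qed.

(** * Modules of the cotree and cuts at a node *)

Definition module (G : graph) (S : {set vert G}) : Prop :=
  forall u v w, u \in S -> v \in S -> w \notin S -> adj u w = adj v w.

Lemma child_module G (S : {set vert G}) c b i : module S ->
  {in S &, forall x y, c x != c y -> adj x y = b} -> module (child S c i).
Proof.
move=> modS adjS u v w; rewrite !inE => /andP[uS /eqP cu] /andP[vS /eqP cv].
have [wS /= cw|wS _] := boolP (w \in S); last exact: modS.
by rewrite !adjS ?cu ?cv // eq_sym.
Qed.

(* Vertices outside the module [S] go to the first part; port 0 is for the vertices
   of [S], port 1 for their outer neighbours, port 2 for the remaining vertices. *)
Lemma node_cut G (S : {set vert G}) c b n : module S -> 0 < n ->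
  {in S, forall x, c x < n} -> {in S &, forall x y, c x != c y -> adj x y = b} ->
  (forall i, i < n -> exists x, x \in child S c i) -> cut_decomp G 3 n.
Proof.
move=> modS n_gt0 ltc adjS ne; apply: cut_parts_decomp.
have [s] := ne 0 n_gt0; rewrite inE => /andP[sS _].
pose R (x y : 'I_3) := match val x, val y with
  | 0, 0 => b | 0, 1 | 1, 0 => true | _, _ => false end.
exists R, (fun x => if x \in S then c x else 0),
  (fun x => if x \in S then inord 0 else if adj s x then inord 1 else inord 2).
split.
- by case=> [[|[|[]]]] //= ? [[|[|[]]]].
- by move=> x; case: ifP => // /ltc.
- by move=> i /ne[x]; rewrite inE => /andP[xS /eqP <-]; exists x; rewrite xS.
move=> x y; rewrite /R.
case: ifPn => xS; case: ifPn => yS; rewrite ?eqxx //.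
- by move/(adjS _ _ xS yS)->; rewrite /= !inordK.
- by move=> _; rewrite (modS x s) //; case: ifP => _; rewrite /= !inordK.
- by move=> _; rewrite adj_sym (modS y s) //; case: ifP => _; rewrite /= !inordK.
Qed.

(** Descend to a node with exactly [outdeg t] children; its vertex set is still a module, so
    [node_cut] applies there. *)
Lemma realizes_cut G t (S : {set vert G}) : realizes t S -> valid_cotree t -> module S ->
  outdeg t = 0 \/ cut_decomp G 3 (outdeg t).
Proof.
elim=> [x|b ts {}S c ltc adjS rz IH /valid_cnode[sz vts] modS]; first by left.
have [->|[i lti ->]] := outdeg_node_attained b ts; last first.
  by apply: IH => //; [apply: (vts i lti).2|apply: child_module adjS].
right; apply: node_cut modS _ ltc adjS _; first exact: leq_trans sz.
by move=> i lti; apply: realizes_neq0 (rz i lti) (vts i lti).2.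
Qed.

Lemma CUT_bounded C : has_CUT C -> cotree_bounded C.
Proof.
case=> f fP; exists (f 3) => G CG t vt /iso_realizes rzt.
have modT : module [set: vert G] by move=> u v w _ _; rewrite inE.
by have [->|/fP->] := realizes_cut rzt vt modT.
Qed.

(** * Separating labels *)

(** Comparison of binary numbers with truth values as digits, the digit [m - 1] being the most
    significant. *)
Fixpoint lexlt (m : nat) (p q : nat -> Prop) : Prop :=
  if m is m'.+1 then (~ p m' /\ q m') \/ ((p m' <-> q m') /\ lexlt m' p q) else False.

Lemma lexlt_irr m p : ~ lexlt m p p.
Proof. by elim: m => //= m IH [[]|[]]. Qed.

Lemma lexlt_trans m p q r : lexlt m p q -> lexlt m q r -> lexlt m p r.
Proof. by elim: m => //= m IH; tauto. Qed.

Lemma lexlt_total m p q j : j < m -> ~ (p j <-> q j) -> lexlt m p q \/ lexlt m q p.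
Proof.
move=> + npq; elim: m => //= m IH; rewrite ltnS leq_eqVlt => /predU1P[Ej|/IH];
  have := classic (p m); have := classic (q m); last by tauto.
by rewrite -Ej; tauto.
Qed.

Lemma lexlt_iff m (p p' q q' : nat -> Prop) : (forall j, j < m -> p j <-> p' j) ->
  (forall j, j < m -> q j <-> q' j) -> lexlt m p q <-> lexlt m p' q'.
Proof.
elim: m => //= m IH Ep Eq.
have {}IH := IH (fun j lt => Ep j (ltnW lt)) (fun j lt => Eq j (ltnW lt)).
by have := Ep m (leqnn _); have := Eq m (leqnn _); tauto.
Qed.

Section ChildOfLca.
Variable G : graph.
Implicit Types (S X Y Z A B : {set vert G}) (b : bool).

(* For [b = false] this is connectedness of the subgraph induced on [X], for [b = true]
   connectedness of its complement. *)
Definition connected b X : Prop := forall Z u v,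
  u \in X -> u \in Z -> v \in X -> v \notin Z ->
  exists u' v', [/\ u' \in X, u' \in Z, v' \in X, v' \notin Z & adj u' v' = ~~ b].

(** [adj x y] is the label of the least common ancestor of [x] and [y]: children of a union are
    connected, children of a join co-connected. *)
Definition separates (x y : vert G) X : Prop :=
  [/\ x \in X, y \notin X, module X & connected (adj x y) X].

Definition largest_separating x y X : Prop :=
  separates x y X /\ forall X', separates x y X' -> X' \subset X.

Lemma largest_separating_uniq x y X X' :
  largest_separating x y X -> largest_separating x y X' -> X = X'.
Proof. by case=> sX lX [sX' lX']; apply/eqP; rewrite eqEsubset lX' ?lX. Qed.

Lemma child_largest_separating S c b x y : module S ->
  {in S &, forall u v, c u != c v -> adj u v = b} ->
  connected b (child S c (c x)) -> x \in S -> y \in S -> c x != c y ->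
  largest_separating x y (child S c (c x)).
Proof.
move=> modS adjS conA xS yS cxy; have axy := adjS x y xS yS cxy.
split; first split; rewrite ?axy // ?inE ?xS ?yS ?eqxx //= 1?eq_sym //.
  exact: child_module adjS.
move=> X [xX nyX modX]; rewrite axy => conX.
(* For a pair [u], [v] of [X] crossing the border of [S], modularity of [S] and then of [X] gives
   [adj u v = adj y v = adj x y = b], against the choice of the pair. *)
have sXS : X \subset S.
  apply/subsetP=> z zX; apply: contraT => zS.
  have [u [v [uX uS vX vS]]] := conX S x z xX xS zX zS.
  by rewrite (modS u y) // adj_sym (modX v x) // axy => /esym; case: b {adjS conA axy conX}.
apply/subsetP=> z zX; apply: contraT => zA.
have [|u [v [uX uA vX vA]]] := conX (child S c (c x)) x z xX _ zX zA.
  by rewrite inE xS eqxx.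
have vS := subsetP sXS v vX; move: uA vA; rewrite !inE vS => /andP[uS /eqP cu] /= cv.
by rewrite adjS // ?cu 1?eq_sym // => /esym; case: b {adjS conA axy conX}.
Qed.

(** Vertices of different children are linked directly, those of one child through a vertex of
    another child. *)
Lemma node_connected S c b n : 1 < n -> {in S, forall x, c x < n} ->
  {in S &, forall u v, c u != c v -> adj u v = ~~ b} ->
  (forall i, i < n -> exists x, x \in child S c i) -> connected b S.
Proof.
move=> n_gt1 ltc adjS ne Z u v uS uZ vS vZ.
have [cuv|cuv] := eqVneq (c u) (c v); last by exists u, v; split=> //; apply: adjS.
have [j ltj cj] : exists2 j, j < n & j != c u.
  by case: (c u) => [|k]; [exists 1|exists 0] => //; apply: ltnW.
have [w] := ne j ltj; rewrite inE => /andP[wS /eqP cw].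
have [wZ|wZ] := boolP (w \in Z).
  by exists w, v; split=> //; apply: adjS => //; rewrite cw -cuv.
by exists u, w; split=> //; apply: adjS => //; rewrite cw eq_sym.
Qed.

Lemma leaf_connected b x : connected b [set x].
Proof. by move=> Z u v /set1P-> xZ /set1P->; rewrite xZ. Qed.

(** * Maximal cliques of unions and joins *)

Definition max_clique S Y : Prop :=
  [/\ {subset Y <= S}, {in Y &, forall u v, u = v \/ adj u v} &
      forall z, z \in S -> z \notin Y -> exists2 y, y \in Y & ~~ adj z y].

Definition has_max_clique S (W : {set vert G}) : Prop :=
  exists2 Y, max_clique S Y & {subset Y <= W}.

Lemma max_clique_neq0 S Y x : max_clique S Y -> x \in S -> exists y, y \in Y.
Proof.
case=> _ _ maxY xS; have [xY|/(maxY x xS)[y yY _]] := boolP (x \in Y); first by exists x.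
by exists y.
Qed.

Lemma has_max_clique1 x W : has_max_clique [set x] W <-> x \in W.
Proof.
split=> [[Y mY YW]|xW].
  have [y yY] := max_clique_neq0 mY (set11 x); apply: YW.
  by case: mY => /(_ y yY)/set1P <-.
exists [set x]; last by move=> y /set1P->.
split=> // [u v /set1P-> /set1P->|z /set1P->]; first by left.
by rewrite set11.
Qed.

(** A nonempty clique lies in one part, and every vertex of another part is nonadjacent to it: a
    union acts as an OR gate. *)
Lemma has_max_clique_union S c n W : {in S, forall x, c x < n} ->
  {in S &, forall u v, c u != c v -> adj u v = false} ->
  (forall i, i < n -> exists x, x \in child S c i) -> 0 < n ->
  has_max_clique S W <-> exists2 i, i < n & has_max_clique (child S c i) W.
Proof.
move=> ltc adjS ne n_gt0; split.
  case=> Y mY YW; have [s] := ne 0 n_gt0; rewrite inE => /andP[sS _].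
  have [y yY] := max_clique_neq0 mY sS; case: mY => YS clY maxY.
  exists (c y); first by apply: ltc; apply: YS.
  exists Y => //; split=> // [z zY|z]; last by rewrite inE => /andP[zS _]; apply: maxY.
  rewrite inE YS //=; apply: contraT => czy.
  have [E|] := clY z y zY yY; first by rewrite E eqxx in czy.
  by rewrite adjS ?YS.
case=> i lti [Y mY YW]; exists Y => //.
have [s si] := ne i lti; have [y yY] := max_clique_neq0 mY si; case: mY => YS clY maxY.
split=> // [z /YS|z zS zY]; first by rewrite inE => /andP[].
have [zi|zi] := eqVneq (c z) i; first by apply: maxY; rewrite ?inE ?zS ?zi /=.
exists y => //; have := YS y yY; rewrite inE => /andP[yS /eqP cy].
by rewrite adjS // cy.
Qed.

(** Maximal cliques restrict to each part and can be assembled from the parts: a join acts as an AND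
    gate. *)
Lemma has_max_clique_join S c n W : {in S, forall x, c x < n} ->
  {in S &, forall u v, c u != c v -> adj u v = true} ->
  has_max_clique S W <-> forall i, i < n -> has_max_clique (child S c i) W.
Proof.
move=> ltc adjS; split.
  case=> Y [YS clY maxY] YW i lti; exists (child Y c i).
    split=> [z|u v|z].
    - by rewrite !inE => /andP[/YS-> ->].
    - by rewrite !inE => /andP[uY _] /andP[vY _]; apply: clY.
    - rewrite !inE => /andP[zS /eqP cz]; rewrite cz eqxx andbT => zY.
      have [y yY nzy] := maxY z zS zY; exists y => //; rewrite inE yY /=.
      by apply: contraNT nzy => cy; apply: adjS; rewrite // ?cz 1?eq_sym //; apply: YS.
  by move=> z; rewrite inE => /andP[/YW].
move=> mW.
have /fin_all_exists[Y mY] (i : 'I_n) : exists Y, max_clique (child S c i) Y /\ {subset Y <= W}.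
  by have [Y] := mW i (ltn_ord i); exists Y.
have YP (x : vert G) (i : 'I_n) : x \in Y i -> x \in S /\ c x = i.
  by have [[YS _ _] _] := mY i => /YS; rewrite inE => /andP[-> /eqP].
exists (\bigcup_i Y i); last by move=> x /bigcupP[i _ xi]; have [_] := mY i; apply.
split.
- by move=> x /bigcupP[i _ /YP[]].
- move=> x y /bigcupP[i _ xi] /bigcupP[j _ yj].
  have [Eij|nij] := eqVneq i j.
    by rewrite -Eij in yj; have [[_ clY _] _] := mY i; apply: clY.
  right; have [xS cx] := YP _ _ xi; have [yS cy] := YP _ _ yj.
  by rewrite adjS // cx cy.
- move=> z zS zY; pose i := Ordinal (ltc z zS).
  have [[_ _ maxY] _] := mY i.
  have [||y yi nzy] := maxY z; first by rewrite inE zS /=.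
    by apply: contra zY => zi; apply/bigcupP; exists i.
  by exists y => //; apply/bigcupP; exists i.
Qed.

Variable m : nat.
Implicit Type W : nat -> {set vert G}.

Definition clique_lt W A B : Prop :=
  lexlt m (fun j => has_max_clique A (W j)) (fun j => has_max_clique B (W j)).

Definition cotree_lt W (x y : vert G) : Prop := exists A B,
  [/\ largest_separating x y A, largest_separating y x B & clique_lt W A B].

Definition strict_order_on W S : Prop :=
  {in S & &, forall x y z, cotree_lt W x y -> cotree_lt W y z -> cotree_lt W x z} /\
  {in S &, forall x y, x != y -> cotree_lt W x y \/ cotree_lt W y x}.

Lemma cotree_lt_irr W x : ~ cotree_lt W x x.
Proof. by case=> A [B [[[xA nxA _ _] _] _ _]]; rewrite xA in nxA. Qed.

(** Between different children [cotree_lt] is the lexicographic comparison of these children; inside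
    one child the order is given. *)
Lemma node_strict_order W S c b n : module S -> {in S, forall x, c x < n} ->
  {in S &, forall u v, c u != c v -> adj u v = b} ->
  (forall i, i < n -> connected b (child S c i)) ->
  (forall i, i < n -> strict_order_on W (child S c i)) ->
  (forall i j, i < n -> j < n -> i != j ->
     clique_lt W (child S c i) (child S c j) \/ clique_lt W (child S c j) (child S c i)) ->
  strict_order_on W S.
Proof.
move=> modS ltc adjS conS ordS totS.
have ltE x y : x \in S -> y \in S -> c x != c y ->
    cotree_lt W x y <-> clique_lt W (child S c (c x)) (child S c (c y)).
  move=> xS yS cxy.
  have lx := child_largest_separating modS adjS (conS _ (ltc x xS)) xS yS cxy.
  have ly : largest_separating y x (child S c (c y)).
    apply: child_largest_separating modS adjS (conS _ (ltc y yS)) yS xS _.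
    by rewrite eq_sym.
  split=> [[A [B [lA lB]]]|]; last by move=> lt; exists (child S c (c x)), (child S c (c y)).
  by rewrite (largest_separating_uniq lx lA) (largest_separating_uniq ly lB).
have inC x : x \in S -> x \in child S c (c x) by move=> xS; rewrite inE xS eqxx.
split=> [x y z xS yS zS|x y xS yS nxy]; last first.
  have [cxy|cxy] := eqVneq (c x) (c y).
    have [_ +] := ordS _ (ltc x xS); apply; rewrite ?inC // cxy ?inC //.
  have nyx : c y != c x by rewrite eq_sym.
  by have := totS _ _ (ltc x xS) (ltc y yS) cxy; rewrite -ltE // -ltE.
have [cxy|cxy] := eqVneq (c x) (c y); have [cyz|cyz] := eqVneq (c y) (c z).
- have [+ _] := ordS _ (ltc x xS); apply; rewrite ?inC // cxy ?inC // cyz ?inC //.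
- by move=> _ /ltE L; apply/ltE; rewrite ?cxy //; apply: L.
- by move=> /ltE L _; apply/ltE; rewrite -?cyz //; apply: L.
- move=> /ltE L1 /ltE L2; have L := lexlt_trans (L1 xS yS cxy) (L2 yS zS cyz).
  (* A return to the child of [x] would place a child strictly below itself. *)
  have [cxz|cxz] := eqVneq (c x) (c z); last exact/ltE.
  by rewrite cxz in L; case: (lexlt_irr L).
Qed.

End ChildOfLca.

Lemma distinct_elements (T : finType) (D : {set T}) n : 0 < n -> n <= #|D| ->
  exists e : nat -> T, (forall i, i < n -> e i \in D) /\
    forall i j, i < n -> j < n -> i != j -> e i != e j.
Proof.
move=> n_gt0 leD.
have /card_gt0P[x0 _] : 0 < #|D| by apply: leq_trans leD.
exists (nth x0 (enum D)); split=> [i lti|i j lti ltj nij].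
  by rewrite -mem_enum mem_nth // -cardE; apply: leq_trans leD.
by rewrite nth_uniq ?enum_uniq // -cardE; apply: leq_trans leD.
Qed.

(* Maximal cliques of a disjoint union are those of its parts, those of a join are unions
   of one for each part; so the set of labels [j] such that [W j] contains a maximal clique
   is the union, resp. the intersection, of the corresponding sets of the children.
   A [d]-set is the union of any two of its [d] subsets of size [d - 1], and a [(d-1)]-set
   the intersection of any two of the [d]-sets above it: the sets of the children can be
   chosen distinct, whatever the prescribed value [s] at the root. *)
Lemma separating_labels G d t (S : {set vert G}) :
  realizes t S -> valid_cotree t -> outdeg t <= d -> module S ->
  forall s : {set 'I_(d + d)}, (forall b, is_node b t -> #|s| = if b then d.-1 else d) ->
  exists W : nat -> {set vert G}, forall W', (forall j, W' j :&: S = W j :&: S) ->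
    (forall j : 'I_(d + d), has_max_clique S (W' j) <-> j \in s) /\
    strict_order_on (d + d) W' S.
Proof.
elim=> [x _ _ _ s _|b ts {}S c ltc adjS rz IH /valid_cnode[sz vts] leD modS s cs].
  (* At a leaf, [W j] is everything or empty according to whether [j] is in [s]. *)
  exists (fun j => [set y | [exists i : 'I_(d + d), (i == j :> nat) && (i \in s)]]).
  move=> W' EW; split.
    move=> j; rewrite has_max_clique1.
    have := EW j; move/setP/(_ x); rewrite !inE eqxx !andbT => ->.
    split=> [/existsP[i /andP[/eqP/val_inj->]]|js] //.
    by apply/existsP; exists j; rewrite eqxx.
  split; last by move=> y z /set1P-> /set1P->; rewrite eqxx.
  by move=> y z w /set1P-> /set1P-> /set1P-> /cotree_lt_irr.
set n := size ts in ltc IH sz vts rz.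
have n_gt0 : 0 < n by apply: leq_trans sz.
have le_nd : n <= d by apply: leq_trans leD; apply: outdeg_node_size.
have d_gt0 : 0 < d by apply: leq_trans le_nd.
have cards : #|s| = if b then d.-1 else d by apply: cs; case: (b).
have ne i : i < n -> exists x, x \in child S c i.
  by move=> lti; apply: realizes_neq0 (rz i lti) (vts i lti).2.
(* One label per child, to be removed from [s] at a union or added at a join. Having [2d] labels
   leaves at least [d] candidates in both cases. *)
have [|e [eD injE]] := @distinct_elements _ (if b then ~: s else s) n n_gt0.
  case: (b) cards => cards; last by rewrite cards.
  rewrite -(leq_add2l #|s|) cardsC card_ord cards leq_add //.
  exact: leq_pred.
pose tg i := if b then e i |: s else s :\ e i.
have /fin_all_exists[Wf WfP] (i : 'I_n) : exists W : nat -> {set vert G}, forall W',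
    (forall j, W' j :&: child S c i = W j :&: child S c i) ->
    (forall j : 'I_(d + d), has_max_clique (child S c i) (W' j) <-> j \in tg i) /\
    strict_order_on (d + d) W' (child S c i).
  have [nb vi] := vts i (ltn_ord i); have eDi := eD i (ltn_ord i).
  apply: IH => //.
  - by apply: leq_trans leD; apply: outdeg_child.
  - exact: child_module adjS.
  - move=> b' nb'; have -> : b' = ~~ b.
      by move: nb'; apply: contraTeq; rewrite negb_eqb; case: (b) nb => nb; case: b'; rewrite ?addbT ?addbF //.
    rewrite /tg; case: (b) cards eDi => cards /=; rewrite ?inE => ei.
      by rewrite cardsU1 ei cards add1n prednK.
    by have := cardsD1 (e i) s; rewrite ei cards add1n => /(congr1 predn).
(* Labels are glued from the children. Each child's claim covers every [W'] with the same trace on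
   it, so it survives the gluing. *)
exists (fun j => [set x | [exists i : 'I_n, (i == c x :> nat) && (x \in Wf i j)]]).
move=> W' EW.
have childP i : i < n ->
    (forall j : 'I_(d + d), has_max_clique (child S c i) (W' j) <-> j \in tg i) /\
    strict_order_on (d + d) W' (child S c i).
  move=> lti; apply: (WfP (Ordinal lti)) => j; apply/setP=> x; rewrite !inE.
  case: (boolP (x \in S)) => xS; rewrite ?andbF //=.
  case: eqP => cx; rewrite ?andbF // !andbT.
  have := EW j; move/setP/(_ x); rewrite !inE xS !andbT => ->.
  apply/existsP/idP => [[i' /andP[/eqP Ei']]|xi].
    by have -> : i' = Ordinal lti by apply: val_inj; rewrite /= Ei'.
  by exists (Ordinal lti); rewrite /= cx eqxx.
split.
  move=> j; have lt1 : 1 < n by [].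
  (* Two children suffice to recover [s]: a given label is changed at no more than one of them. *)
  have ne01 : e 0 != e 1 by apply: injE.
  have tgP i (lti : i < n) : has_max_clique (child S c i) (W' j) <-> j \in tg i.
    exact: (childP i lti).1.
  rewrite /tg in tgP; case: (b) adjS tgP => adjS tgP.
    split=> [/(has_max_clique_join _ ltc adjS) H|js]; last first.
      by apply/(has_max_clique_join _ ltc adjS) => i lti; apply/tgP; rewrite // !inE js orbT.
    have /(tgP 0 n_gt0) := H 0 n_gt0; rewrite !inE => /predU1P[E0|//].
    have /(tgP 1 lt1) := H 1 lt1; rewrite !inE => /predU1P[E1|//].
    by rewrite -E0 E1 eqxx in ne01.
  split=> [/(has_max_clique_union _ ltc adjS ne n_gt0)[i lti /(tgP i lti)]|js].
    by rewrite !inE => /andP[].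
  apply/(has_max_clique_union _ ltc adjS ne n_gt0).
  have [E0|nj0] := eqVneq j (e 0).
    by exists 1 => //; apply/tgP; rewrite // !inE js andbT E0.
  by exists 0 => //; apply/tgP; rewrite // !inE js andbT.
apply: node_strict_order modS ltc adjS _ _ _.
(* An inner child carries the opposite label, hence is connected in the sense required by [b]. *)
- move=> i lti; have [nb vi] := vts i lti; move: (rz i lti) nb vi.
  case=> [x|b' ts' S' c' ltc' adjS' rz' nb /valid_cnode[sz' vts']].
    by move=> *; apply: leaf_connected.
  apply: (node_connected sz' ltc').
    have <- : b' = ~~ b; last exact: adjS'.
    by move: nb; case: (b); case: (b').
  by move=> k ltk; apply: realizes_neq0 (rz' k ltk) (vts' k ltk).2.
- by move=> i /childP[].
(* The label [e i] lies in exactly one of [tg i] and [tg j]. *)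
- move=> i j lti ltj nij; apply: lexlt_total (ltn_ord (e i)) _.
  have [/(_ (e i)) -> _] := childP i lti; have [/(_ (e i)) -> _] := childP j ltj.
  have nE := injE _ _ lti ltj nij; have := eD i lti.
  by rewrite /tg; case: (b); rewrite !inE eqxx /= (negPf nE) => ei; rewrite ?(negPf ei) ?ei; case; auto.
Qed.

(** * Definability of the order *)

Definition MImp f g := MOr (MNot f) g.
Definition MIff f g := MOr (MAnd f g) (MAnd (MNot f) (MNot g)).

(** Element variables 0 and 1 hold the compared vertices. Set variables 0 and 1 hold the two
    children, 2 a competing module, 3 a test set for connectedness, 4 a clique. *)
Definition mso_module X :=
  MAll 2 (MAll 3 (MAll 4 (MImp (MAnd (MIn 2 X) (MAnd (MIn 3 X) (MNot (MIn 4 X))))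
                               (MIff (MEdge 2 4) (MEdge 3 4))))).

Definition mso_connected x y X :=
  MAllS 3 (MAll 2 (MAll 3
    (MImp (MAnd (MAnd (MIn 2 X) (MIn 2 3)) (MAnd (MIn 3 X) (MNot (MIn 3 3))))
          (MEx 4 (MEx 5
            (MAnd (MAnd (MAnd (MIn 4 X) (MIn 4 3)) (MAnd (MIn 5 X) (MNot (MIn 5 3))))
                  (MIff (MEdge 4 5) (MNot (MEdge x y))))))))).

Definition mso_separates x y X :=
  MAnd (MAnd (MIn x X) (MNot (MIn y X))) (MAnd (mso_module X) (mso_connected x y X)).

Definition mso_largest x y X :=
  MAnd (mso_separates x y X)
       (MAllS 2 (MImp (mso_separates x y 2) (MAll 2 (MImp (MIn 2 2) (MIn 2 X))))).

Definition mso_clique X Z :=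
  MExS 4 (MAnd (MAnd
    (MAll 2 (MImp (MIn 2 4) (MAnd (MIn 2 X) (MIn 2 Z))))
    (MAll 2 (MAll 3 (MImp (MAnd (MIn 2 4) (MIn 3 4)) (MOr (MEq 2 3) (MEdge 2 3))))))
    (MAll 2 (MImp (MAnd (MIn 2 X) (MNot (MIn 2 4)))
                  (MEx 3 (MAnd (MIn 3 4) (MNot (MEdge 2 3))))))).

(** Set variable [j + 5] holds the label set [W j]; the base case is an unsatisfiable formula. *)
Fixpoint mso_lex m :=
  if m is m'.+1 then
    let p := mso_clique 0 m'.+4.+1 in let q := mso_clique 1 m'.+4.+1 in
    MOr (MAnd (MNot p) q) (MAnd (MIff p q) (mso_lex m'))
  else MEx 2 (MNot (MEq 2 2)).

(* Set variables 0 to 4 are bound; the parameters are the set variables from 5 on. *)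
Definition mso_order m :=
  MOr (MEq 0 1)
      (MExS 0 (MExS 1 (MAnd (MAnd (mso_largest 0 1 0) (mso_largest 1 0 1)) (mso_lex m)))).

Lemma mso_lex_fo m : fo_fv (mso_lex m) = [::].
Proof. by elim: m => //= m ->. Qed.

Lemma mso_clique_so X Z : {subset so_fv (mso_clique X Z) <= [:: X; Z]}.
Proof.
move=> Y; rewrite mem_filter !inE /= => /andP[/negPf->] /=.
by rewrite !orbF; case: (Y == X); case: (Y == Z).
Qed.

Lemma mso_lex_so m : all (fun X => X < m + 5) (so_fv (mso_lex m)).
Proof.
elim: m => // m IH.
have cliqueP a : a < 5 -> all (fun X => X < m.+1 + 5) (so_fv (mso_clique a m.+4.+1)).
  move=> lta; apply/allP=> Y /mso_clique_so; rewrite !inE => /orP[]/eqP->.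
    exact: leq_trans (leq_addl _ _).
  by rewrite addSn addnC.
have {}IH : all (fun X => X < m.+1 + 5) (so_fv (mso_lex m)).
  by apply: sub_all IH => X; apply: ltnW.
set p := mso_clique 0 m.+4.+1; set q := mso_clique 1 m.+4.+1.
have -> : so_fv (mso_lex m.+1) =
    (so_fv p ++ so_fv q) ++ ((so_fv p ++ so_fv q) ++ (so_fv p ++ so_fv q)) ++ so_fv (mso_lex m).
  by [].
by rewrite !all_cat !cliqueP // IH.
Qed.

(** * Semantics of the formulas *)

Lemma imp_or (P Q : Prop) : (~ P \/ Q) <-> (P -> Q).
Proof. by have := classic P; tauto. Qed.

Lemma eq_bool_or (a b : bool) : (a /\ b \/ ~ a /\ ~ b) <-> a = b.
Proof.
split=> [[[-> ->]|[/negP/negbTE-> /negP/negbTE->]]|->] //.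
by case: b; [left|right].
Qed.

Lemma sat_module G (nu : nat -> vert G) mu X :
  sat nu mu (mso_module X) <-> module (mu X).
Proof.
rewrite /= /upd /=; split=> [H u v w uX vX /negP wX|H u v w].
  by have /imp_or/(_ (conj uX (conj vX wX)))/eq_bool_or := H u v w.
by apply/imp_or => -[uX [vX /negP wX]]; apply/eq_bool_or; apply: H.
Qed.

Lemma sat_connected G (nu : nat -> vert G) mu x y X : x < 2 -> y < 2 -> X < 3 ->
  sat nu mu (mso_connected x y X) <-> connected (adj (nu x) (nu y)) (mu X).
Proof.
move=> x2 y2 X3.
have -> : sat nu mu (mso_connected x y X) <-> forall (Z : {set vert G}) u v,
    ~ ((u \in mu X /\ u \in Z) /\ (v \in mu X /\ ~ v \in Z)) \/
    exists u' v', ((u' \in mu X /\ u' \in Z) /\ (v' \in mu X /\ ~ v' \in Z)) /\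
      (adj u' v' /\ ~ adj (nu x) (nu y) \/ ~ adj u' v' /\ ~ ~ adj (nu x) (nu y)).
  (* Once the indices are numerals, the updated assignments compute. *)
  by move: x y X x2 y2 X3 => [|[|x]] [|[|y]] [|[|[|X]]] // _ _ _; split.
split=> H Z u v.
  move=> uX uZ vX /negP vZ.
  have /imp_or/(_ (conj (conj uX uZ) (conj vX vZ))) := H Z u v.
  case=> u' [v' [[[u'X u'Z] [v'X /negP v'Z]] E]]; exists u', v'; split=> //.
  by move: E; case: (adj u' v'); case: (adj _ _) => //=; tauto.
apply/imp_or => -[[uX uZ] [vX /negP vZ]].
have [u' [v' [u'X u'Z v'X /negP v'Z E]]] := H Z u v uX uZ vX vZ.
by exists u', v'; split=> //; rewrite E; case: (adj _ _) => /=; [right; split=> // H|left]; auto.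
Qed.

Lemma sat_separates G (nu : nat -> vert G) mu x y X : x < 2 -> y < 2 -> X < 3 ->
  sat nu mu (mso_separates x y X) <-> separates (nu x) (nu y) (mu X).
Proof.
move=> x2 y2 X3.
have -> : sat nu mu (mso_separates x y X) <-> (nu x \in mu X /\ ~ nu y \in mu X) /\
    (sat nu mu (mso_module X) /\ sat nu mu (mso_connected x y X)) by split.
rewrite sat_module sat_connected //; split=> [[[? /negP ?] [? ?]]|[? /negP ? ? ?]] //.
Qed.

Lemma sat_largest G (nu : nat -> vert G) mu x y X : x < 2 -> y < 2 -> X < 2 ->
  sat nu mu (mso_largest x y X) <-> largest_separating (nu x) (nu y) (mu X).
Proof.
move=> x2 y2 X2.
have -> : sat nu mu (mso_largest x y X) <-> sat nu mu (mso_separates x y X) /\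
    forall X' : {set vert G}, ~ sat nu (upd mu 2 X') (mso_separates x y 2) \/
      forall u, ~ (u \in X') \/ u \in mu X.
  by move: X X2 => [|[|X]] // _; split.
have X3 := ltnW X2 : X < 3.
rewrite sat_separates //; split=> -[sX lX]; split=> // X'.
  move=> sX'; apply/subsetP=> u; have /imp_or := lX X'.
  by rewrite sat_separates // => /(_ sX' u)/imp_or.
apply/imp_or; rewrite sat_separates // => /lX/subsetP sub u.
by apply/imp_or => /sub.
Qed.

Lemma sat_clique G (nu : nat -> vert G) mu X Z : X < 4 -> 4 < Z ->
  sat nu mu (mso_clique X Z) <-> has_max_clique (mu X) (mu Z).
Proof.
move=> X4 Z4.
have -> : sat nu mu (mso_clique X Z) <-> exists Y : {set vert G},
    ((forall u, ~ (u \in Y) \/ (u \in mu X /\ u \in mu Z)) /\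
     (forall u v, ~ (u \in Y /\ v \in Y) \/ (u = v \/ adj u v))) /\
    forall u, ~ (u \in mu X /\ ~ u \in Y) \/ exists v, v \in Y /\ ~ adj u v.
  by move: X X4 Z Z4 => [|[|[|[|X]]]] // _ [|[|[|[|[|Z]]]]] // _; split.
split=> [[Y [[sY cY] mY]]|[Y [sY cY mY] YZ]]; exists Y.
- split=> [u|u v uY vY|z zX zY]; first by have /imp_or H := sY u => /H[].
    by have /imp_or := cY u v; apply.
  by have /imp_or[|v [vY /negP]] := mY z; [split=> //; apply/negP|exists v].
- by move=> u uY; have /imp_or/(_ uY)[] := sY u.
split; first split.
- by move=> u; apply/imp_or => uY; split; [apply: sY|apply: YZ].
- by move=> u v; apply/imp_or => -[uY vY]; apply: cY.
move=> u; apply/imp_or => -[uX /negP uY]; have [v vY nuv] := mY u uX uY.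
by exists v; split=> //; apply/negP.
Qed.

Lemma sat_lex G (nu : nat -> vert G) mu m : sat nu mu (mso_lex m) <->
  clique_lt m (fun j => mu j.+4.+1) (mu 0) (mu 1).
Proof.
rewrite /clique_lt; elim: m => [|m IH]; first by split=> //= -[v]; apply.
set p := mso_clique 0 m.+4.+1; set q := mso_clique 1 m.+4.+1.
have -> : sat nu mu (mso_lex m.+1) <-> (~ sat nu mu p /\ sat nu mu q) \/
    ((sat nu mu p /\ sat nu mu q \/ ~ sat nu mu p /\ ~ sat nu mu q) /\ sat nu mu (mso_lex m)).
  by split.
rewrite IH !sat_clique //=.
by have := classic (has_max_clique (mu 0) (mu m.+4.+1));
  have := classic (has_max_clique (mu 1) (mu m.+4.+1)); tauto.
Qed.

Lemma sat_order G (nu : nat -> vert G) mu m : sat nu mu (mso_order m) <->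
  nu 0 = nu 1 \/ cotree_lt m (fun j => mu j.+4.+1) (nu 0) (nu 1).
Proof.
have -> : sat nu mu (mso_order m) <-> nu 0 = nu 1 \/ exists A B,
    let mu' := upd (upd mu 0 A) 1 B in
    (sat nu mu' (mso_largest 0 1 0) /\ sat nu mu' (mso_largest 1 0 1)) /\
    sat nu mu' (mso_lex m) by split.
suff -> : (exists A B, let mu' := upd (upd mu 0 A) 1 B in
    (sat nu mu' (mso_largest 0 1 0) /\ sat nu mu' (mso_largest 1 0 1)) /\
    sat nu mu' (mso_lex m)) <-> cotree_lt m (fun j => mu j.+4.+1) (nu 0) (nu 1) by [].
split=> -[A [B]] H; exists A, B; move: H; cbv zeta; rewrite !sat_largest // sat_lex.
  by case=> -[].
by case.
Qed.

Lemma subset_of_card m k : k <= m -> exists s : {set 'I_m}, #|s| = k.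
Proof.
move=> lek; exists [set i in take k (enum 'I_m)].
rewrite cardsE; have /card_uniqP -> := take_uniq k (enum_uniq 'I_m).
by rewrite size_takel // size_enum_ord.
Qed.

Lemma bounded_orderable C : (forall G, C G -> is_cograph G) ->
  cotree_bounded C -> mso_orderable C.
Proof.
move=> cogC [d bdC]; set m := d + d.
exists (mso_order m), (m + 5); split.
  by apply/allP; rewrite /= mso_lex_fo.
split.
  have -> : so_fv (mso_order m) = filter (predC1 0) (filter (predC1 1)
    ((so_fv (mso_largest 0 1 0) ++ so_fv (mso_largest 1 0 1)) ++ so_fv (mso_lex m))) by [].
  apply/allP => X; rewrite !mem_filter mem_cat => /and3P[/= X0 X1 /orP[]].
    by move: X X0 X1; do 5?[case=> //].
  by move=> XF; apply: (allP (mso_lex_so m)).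
move=> G CG neG; have [t [vt isot]] := cogC G CG.
(* The size of the root set follows the root label; a leaf allows any size. *)
have [s cards] : exists s : {set 'I_m}, forall b, is_node b t -> #|s| = if b then d.-1 else d.
  have [|s Es] := @subset_of_card m (if is_join t then d.-1 else d).
    by case: ifP => _; rewrite ?leq_addr // (leq_trans (leq_pred d)) ?leq_addr.
  by exists s; case=> /= Hb; rewrite Es; move: Hb; case: (t).
have modT : module [set: vert G] by move=> u v w _ _; rewrite inE.
have [W WP] := separating_labels (iso_realizes isot) vt (bdC G CG t vt isot) modT cards.
have [_ [tr tot]] := WP W (fun=> erefl).
(* Five dummy sets fill the positions of the bound set variables. *)
pose P := nseq 5 set0 ++ mkseq W m.
exists P; split; first by rewrite size_cat size_nseq size_mkseq addnC.
have ltE a b : sat (fun i => if i == 0 then a else b) (fun X => nth set0 P X) (mso_order m)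
    <-> a = b \/ cotree_lt m W a b.
  rewrite sat_order /=; suff -> : cotree_lt m (nth set0 (mkseq W m)) a b <-> cotree_lt m W a b by [].
  have cE A B : clique_lt m (nth set0 (mkseq W m)) A B <-> clique_lt m W A B.
    by apply: lexlt_iff => j ltj; rewrite nth_mkseq.
  by split=> -[A [B [lA lB /cE lt]]]; exists A, B.
split; first by move=> a; apply/ltE; left.
split.
  move=> a b /ltE[->//|lab] /ltE[->//|lba].
  by case: (@cotree_lt_irr G m W a); apply: (tr a b a).
split.
  move=> a b c /ltE[->//|lab] /ltE[<-|lbc]; apply/ltE; right=> //.
  by apply: (tr a b c).
move=> a b; have [->|nab] := eqVneq a b; first by left; apply/ltE; left.
by case: (tot a b) => // lt; [left|right]; apply/ltE; right.
Qed.

Theorem theorem5p14 (C : graph -> Prop) (HC : forall G, C G -> is_cograph G) :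
  (mso_orderable C <-> has_CUT C) /\ (has_CUT C <-> cotree_bounded C).
Proof.
have ord_cut := @orderable_CUT C; have cut_bd := @CUT_bounded C.
have bd_ord := bounded_orderable HC.
by split; split; auto.
Qed.
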